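(* If $G$ is a planar WTD(2) graph with minimum degree $\delta(G)\geq 3$, then $|V(G)|\leq 16$.
   Context: Graphs are finite and simple. A total dominating set (TDS) of a graph $G$ with no isolated vertices is a set $S\subseteq V(G)$ such that every vertex of $G$ is adjacent to at least one element of $S$; it is minimal if it contains no other TDS. $\gamma_t(G)$ is the minimum size of a TDS. $G$ is well-totally-dominated (WTD) if it has no isolated vertices and all its minimal TDSs have the same size. A WTD(2) graph is a WTD graph with $\gamma_t(G)=2$. *)

(* Defs.v *)
From mathcomp Require Import all_boot all_order all_algebra.
From mathcomp Require Import all_classical all_reals all_analysis.

Set Implicit Arguments.
Unset Strict Implicit.
Unset Printing Implicit Defensive.

Import numFieldNormedType.Exports.

(* A finite simple graph is a symmetric irreflexive relation e on a finType. *)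

Definition simple_graph (T : finType) (e : rel T) : Prop :=
  symmetric e /\ irreflexive e.

Definition no_isolated (T : finType) (e : rel T) : bool :=
  [forall v : T, [exists u : T, e v u]].

Definition degree (T : finType) (e : rel T) (v : T) : nat :=
  #|[pred u | e v u]|.

(* The default #|T| exceeds every degree, so it only matters when T is empty,
   where the value is 0. *)
Definition min_degree (T : finType) (e : rel T) : nat :=
  \big[minn/#|T|]_(v : T) degree e v.

Definition total_dominating (T : finType) (e : rel T) (S : {set T}) : bool :=
  [forall v : T, [exists u in S, e v u]].

(* When no vertex is isolated, [set: T] is total dominating, so the arg min
   is genuine. *)
Definition total_domination_number (T : finType) (e : rel T) : nat :=
  #|[arg min_(S < [set: T]%SET | total_dominating e S) #|S|]|.

Definition well_totally_dominated (T : finType) (e : rel T) : Prop :=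
  no_isolated e /\
  forall S S' : {set T},
    minset (total_dominating e) S -> minset (total_dominating e) S' ->
    #|S| = #|S'|.

Definition wtd (k : nat) (T : finType) (e : rel T) : Prop :=
  well_totally_dominated e /\ total_domination_number e = k.

Local Open Scope ring_scope.
Local Open Scope classical_set_scope.

Definition arc_between (R : realType) (a b : R * R) (A : set (R * R)) : Prop :=
  exists g : R -> R * R,
    [/\ {within `[0, 1], continuous g},
        {in `[0, 1] &, injective g},
        g 0 = a, g 1 = b & A = g @` `[0, 1]].

(* A drawing of e in the plane: p places the vertices, and arc E is the curve
   of the edge E, given as the 2-set of its ends (values of arc on sets that
   are not edges are irrelevant).  The interior of an edge contains no vertex
   and no point of any other edge. *)
Definition plane_drawing (R : realType) (T : finType) (e : rel T)
    (p : T -> R * R) (arc : {set T} -> set (R * R)) : Prop :=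
  [/\ injective p,
      forall x y : T, e x y -> arc_between (p x) (p y) (arc [set x; y]%SET),
      forall x y z : T, e x y ->
        ~ (arc [set x; y]%SET `\` [set p x; p y]) (p z) &
      forall x y u v : T, e x y -> e u v ->
        [set x; y]%SET <> [set u; v]%SET ->
        (arc [set x; y]%SET `\` [set p x; p y]) `&` arc [set u; v]%SET = set0].

Definition planar (R : realType) (T : finType) (e : rel T) : Prop :=
  exists (p : T -> R * R) (arc : {set T} -> set (R * R)),
    plane_drawing e p arc.

(* Main.v *)
Require Import Defs.
From mathcomp Require Import all_boot all_order all_algebra.
From mathcomp Require Import all_classical all_reals all_analysis.
From mathcomp Require Import zify ring lra.

(** A total dominating set of size 2 meets every open neighbourhood.  As degrees
are at least 3, the complement of any two vertices is total dominating, hence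
contains such a pair.  Choosing a pair [a0, a1], then for each [ai] a pair
[cij] avoiding it, then for each [ai], [cij] a pair avoiding both, gives eight
triples such that every vertex is adjacent to a whole triple.  With more than
16 vertices some triple has three common neighbours, which is a K33.

K33 is not planar: for disjoint arcs [f] and [g], the direction [f s - g t]
never vanishes on the square, so the signed number of half-turns it makes along
the boundary of the square is 0.  This number is a sum of four integers, each
the half-turns of an edge of K33 seen from an end of a disjoint edge.  In a
suitable signed sum of the 18 relations everything cancels but an alternating
sum over [j <> l] of the half-turns of the edges [a bj] seen from [bl], where
[a] is a fixed vertex and the [bj] are its three neighbours.  It is odd, since
each pair [bj - bl], [bl - bj] has exactly one member in the upper
half plane: a contradiction. *)

Set Implicit Arguments.
Unset Strict Implicit.
Unset Printing Implicit Defensive.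

Import Order.TTheory GRing.Theory Num.Theory numFieldNormedType.Exports.

Local Open Scope ring_scope.
Local Open Scope classical_set_scope.

(** * Half-turns between plane vectors *)

Section HalfTurns.
Context {R : realDomainType}.
Implicit Types u v : R * R.

(** The positive horizontal axis counts as upper and the negative one does not, so that negation
    exchanges the two halves off the origin. *)
Definition upper u : bool := (0 < u.2) || (u.2 == 0) && (0 < u.1).

Lemma upperN u : u != 0 -> upper (- u) = ~~ upper u.
Proof.
case: u => x y; rewrite /upper /= -pair_eqE /= !oppr_gt0 oppr_eq0.
by case: (ltgtP y 0) => //=; case: (ltgtP x 0).
Qed.

(* The signed number of crossings of the horizontal axis when turning from [u]
   to [v] through the smaller angle. *)
Definition half_turn u v : int :=
  if upper u == upper v then 0
  else if 0 < u.1 * v.2 - u.2 * v.1 then 1 else -1.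

Lemma half_turnN u v :
  u != 0 -> v != 0 -> half_turn (- u) (- v) = half_turn u v.
Proof.
move=> u0 v0; rewrite /half_turn !upperN //= !mulrNN.
by case: (upper u); case: (upper v).
Qed.

Lemma half_turn_parity u v :
  exists k : int, half_turn u v = (upper u)%:Z + (upper v)%:Z + 2 * k.
Proof.
rewrite /half_turn; case: (upper u); case: (upper v) => /=.
- by exists (-1).
- by case: ifP => _; [exists 0 | exists (-1)].
- by case: ifP => _; [exists 0 | exists (-1)].
- by exists 0.
Qed.

Definition coord_signed (A : set (R * R)) : Prop :=
  [\/ A `<=` [set u | 0 < u.1], A `<=` [set u | u.1 < 0],
      A `<=` [set u | 0 < u.2] | A `<=` [set u | u.2 < 0]].

(** Right of the vertical axis, going up is a counterclockwise turn; left of it, a clockwise one;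
    strictly above or below the horizontal axis nothing is crossed. *)
Lemma half_turn_coboundary (A : set (R * R)) : coord_signed A ->
  exists c : int, forall u v, A u -> A v ->
    half_turn u v = c * ((upper v)%:Z - (upper u)%:Z).
Proof.
case=> sA; [exists 1 | exists (-1) | exists 0 | exists 0];
  move=> [x y] [x' y'] /sA /= ux /sA /= vx; rewrite /half_turn /upper /=.
- rewrite ux vx !andbT.
  case: (ltgtP y 0) => hy; case: (ltgtP y' 0) => hy' //=; case: ifPn => //;
    rewrite -?leNgt => h; exfalso; nra.
- rewrite (lt_gtF ux) (lt_gtF vx) !andbF !orbF.
  case: (ltgtP y 0) => hy; case: (ltgtP y' 0) => hy' //=; case: ifPn => //;
    rewrite -?leNgt => h; exfalso; nra.
- by rewrite ux vx.
- by rewrite (lt_gtF ux) (lt_gtF vx) (lt_eqF ux) (lt_eqF vx).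
Qed.

Lemma half_turn_square (A : set (R * R)) u v u' v' : coord_signed A ->
  A u -> A v -> A u' -> A v' ->
  half_turn u v + half_turn v v' = half_turn u u' + half_turn u' v'.
Proof.
move=> /half_turn_coboundary[c cE] Au Av Au' Av'.
by rewrite !cE//; ring.
Qed.

End HalfTurns.

(** A discrete Green formula: in the sum of the cell relations the inner sides cancel. *)
Lemma grid_boundary (V : zmodType) (h v : nat -> nat -> V) (n m : nat) :
  (forall i j, (i < n)%N -> (j < m)%N ->
    h i j + v i.+1 j = v i j + h i j.+1) ->
  \sum_(i < n) h i 0%N + \sum_(j < m) v n j =
  \sum_(j < m) v 0%N j + \sum_(i < n) h i m.
Proof.
move=> sq; elim: n m sq => [m _|n IHn m sq].
  by rewrite !big_ord0 add0r addr0.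
have {IHn}IH := IHn m (fun i j lin ljm => sq i j (ltnW lin) ljm).
have col : h n 0%N + \sum_(j < m) v n.+1 j = \sum_(j < m) v n j + h n m.
  elim: m sq {IH} => [|m IHm] sq; first by rewrite !big_ord0 add0r addr0.
  rewrite !big_ord_recr /= addrA IHm => [|i j lin ljm].
    by rewrite -!addrA (sq n m).
  exact: sq (ltnW ljm).
by rewrite !big_ord_recr /= -addrA col addrA IH addrA.
Qed.

(** * Half-turns along arcs *)

Section Arcs.
Context {R : realType}.
Implicit Types (f g : R -> R * R) (p q : R * R).

Lemma lt_near_within (A : set R) (phi psi : R -> R) (s t : R) :
  phi x @[x --> within A (nbhs s)] --> phi s ->
  psi x @[x --> within A (nbhs t)] --> psi t ->
  phi s < psi t ->
  exists2 e : R, 0 < e & forall x y, A x -> A y ->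
    `|s - x| < e -> `|t - y| < e -> phi x < psi y.
Proof.
move=> cphi cpsi /midf_lt[lts ltt]; set c := (_ / _) in lts ltt.
have := cphi _ (lt_nbhsl lts); move=> /nbhs_ballP[d /= d0 dP].
have := cpsi _ (lt_nbhsr ltt); move=> /nbhs_ballP[e /= e0 eP].
exists (Num.min d e) => [|x y Ax Ay]; first by rewrite lt_min d0.
rewrite !lt_min => /andP[xd _] /andP[_ ye].
exact: lt_trans (dP _ xd Ax) (eP _ ye Ay).
Qed.

(** Compactness of the square turns a local choice of mesh into a uniform one. *)
Lemma near_coord_signed f g :
  {within `[0, 1], continuous f} -> {within `[0, 1], continuous g} ->
  (forall s t : R, s \in `[0, 1]%R -> t \in `[0, 1]%R -> f s != g t) ->
  \forall n \near \oo, forall s t : R, s \in `[0, 1]%R -> t \in `[0, 1]%R ->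
    coord_signed [set u | exists x y : R, [/\ x \in `[0, 1]%R, y \in `[0, 1]%R,
      `|s - x| <= n.+1%:R^-1, `|t - y| <= n.+1%:R^-1 & u = f x - g y]].
Proof.
move=> /subspace_continuousP cf /subspace_continuousP cg fg.
pose P (n : nat) (st : R * R) :=
  coord_signed [set u | exists x y : R, [/\ x \in `[0, 1]%R, y \in `[0, 1]%R,
    `|st.1 - x| <= n.+1%:R^-1, `|st.2 - y| <= n.+1%:R^-1 & u = f x - g y]].
suff : \forall n \near \oo, `[0, 1] `*` `[0, 1] `<=` P n.
  apply: filterS => n nP s t s01 t01.
  by apply: (nP (s, t)); split; rewrite /= ?s01 ?t01.
have /compact_near_coveringP : compact (`[0 : R, 1] `*` `[0 : R, 1]).
  by apply: compact_setX; exact: segment_compact.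
apply => -[s t] [/= s01 t01].
have cf1 : (f x).1 @[x --> within `[0, 1] (nbhs s)] --> (f s).1.
  by apply: cvg_comp (cf s s01) _; exact: cvg_fst.
have cf2 : (f x).2 @[x --> within `[0, 1] (nbhs s)] --> (f s).2.
  by apply: cvg_comp (cf s s01) _; exact: cvg_snd.
have cg1 : (g x).1 @[x --> within `[0, 1] (nbhs t)] --> (g t).1.
  by apply: cvg_comp (cg t t01) _; exact: cvg_fst.
have cg2 : (g x).2 @[x --> within `[0, 1] (nbhs t)] --> (g t).2.
  by apply: cvg_comp (cg t t01) _; exact: cvg_snd.
(* Some coordinate of [f s - g t] is nonzero, hence keeps its sign nearby. *)
suff [e e0 eP] : exists2 e : R, 0 < e & coord_signed [set u |
    exists x y : R, [/\ x \in `[0, 1]%R, y \in `[0, 1]%R,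
      `|s - x| < e, `|t - y| < e & u = f x - g y]].
  (* One half of [e] pays for moving the centre to [st], the other for the mesh. *)
  have e20 : 0 < e / 2 by rewrite divr_gt0.
  near=> st n.
  have [ss tt] : ball (s, t) (e / 2) st by near: st; exact: nbhsx_ballx.
  have ne : n.+1%:R^-1 < e / 2.
    by near: n; exact: (near_infty_natSinv_lt (PosNum e20)).
  have sub (A B : set (R * R)) : A `<=` B -> coord_signed B -> coord_signed A.
    move=> AB; case=> BP; [apply: Or41|apply: Or42|apply: Or43|apply: Or44];
      exact: subset_trans BP.
  apply: sub eP => u [x [y [x01 y01 sx ty ->]]]; exists x, y; split => //.
    apply: le_lt_trans (ler_distD st.1 s x) _; rewrite (splitr e).
    by rewrite ltrD //; exact: le_lt_trans sx ne.
  apply: le_lt_trans (ler_distD st.2 t y) _; rewrite (splitr e).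
  by rewrite ltrD //; exact: le_lt_trans ty ne.
have : f s != g t by exact: fg.
rewrite -pair_eqE /= negb_and => /orP[] /lt_total/orP[] lt.
- have [e e0 eP] := lt_near_within cf1 cg1 lt; exists e => //; apply: Or42.
  by move=> _ [x [y [x01 y01 sx ty ->]]] /=; rewrite subr_lt0; exact: eP.
- have [e e0 eP] := lt_near_within cg1 cf1 lt; exists e => //; apply: Or41.
  by move=> _ [x [y [x01 y01 sx ty ->]]] /=; rewrite subr_gt0; exact: eP.
- have [e e0 eP] := lt_near_within cf2 cg2 lt; exists e => //; apply: Or44.
  by move=> _ [x [y [x01 y01 sx ty ->]]] /=; rewrite subr_lt0; exact: eP.
- have [e e0 eP] := lt_near_within cg2 cf2 lt; exists e => //; apply: Or43.
  by move=> _ [x [y [x01 y01 sx ty ->]]] /=; rewrite subr_gt0; exact: eP.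
Unshelve. all: by end_near. Qed.

Definition half_turns (n : nat) f p : int :=
  \sum_(i < n.+1)
    half_turn (f (i%:R / n.+1%:R) - p) (f (i.+1%:R / n.+1%:R) - p).

(** Modulo 2 a half-turn is the change of [upper], so the sum telescopes for every subdivision. *)
Lemma half_turns_parity n f p : exists k : int,
  half_turns n f p = (upper (f 0 - p))%:Z + (upper (f 1 - p))%:Z + 2 * k.
Proof.
have H m : exists k : int,
    \sum_(i < m) half_turn (f (i%:R / n.+1%:R) - p) (f (i.+1%:R / n.+1%:R) - p)
    = (upper (f 0 - p))%:Z + (upper (f (m%:R / n.+1%:R) - p))%:Z + 2 * k.
  elim: m => [|m [k IH]].
    by rewrite big_ord0 mul0r; exists (- (upper (f 0 - p))%:Z); ring.
  rewrite big_ord_recr /= IH.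
  have [k' ->] := half_turn_parity (f (m%:R / n.+1%:R) - p)
                                   (f (m.+1%:R / n.+1%:R) - p).
  exists (k + k' + (upper (f (m%:R / n.+1%:R) - p))%:Z); ring.
by have := H n.+1; rewrite divff ?pnatr_eq0.
Qed.

(** On a fine grid [f s - g t] is [coord_signed] on each cell, so the cell relations hold and
    [grid_boundary] adds them up. *)
Lemma half_turns_rectangle f g :
  {within `[0, 1], continuous f} -> {within `[0, 1], continuous g} ->
  (forall s t : R, s \in `[0, 1]%R -> t \in `[0, 1]%R -> f s != g t) ->
  \forall n \near \oo,
    half_turns n f (g 0) + half_turns n g (f 1) =
    half_turns n g (f 0) + half_turns n f (g 1).
Proof.
move=> cf cg fg; have := near_coord_signed cf cg fg.
apply: filterS => n nP.
pose x i : R := i%:R / n.+1%:R.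
have x01 i : (i <= n.+1)%N -> x i \in `[0, 1]%R.
  by move=> i_le; rewrite in_itv /= divr_ge0 //= ler_pdivrMr // mul1r ler_nat.
have x1 : x n.+1 = 1 by rewrite /x divff // pnatr_eq0.
have x0 : x 0%N = 0 by rewrite /x mul0r.
have xS i : `|x i - x i.+1| <= n.+1%:R^-1.
  by rewrite /x -mulrBl -natr1 opprD addNKr mulN1r normrN ger0_norm.
pose F i j := f (x i) - g (x j).
(* Seen from [f], the arc [g] has direction [- F]; negation preserves half-turns. *)
have gE t : (t <= n.+1)%N -> half_turns n g (f (x t)) =
    \sum_(j < n.+1) half_turn (F t j) (F t j.+1).
  move=> tn; apply: eq_bigr => j _.
  have F0 k : (k <= n.+1)%N -> F t k != 0.
    by move=> kn; rewrite subr_eq0 fg ?x01.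
  by rewrite -(half_turnN (F0 _ (ltnW (ltn_ord j))) (F0 _ (ltn_ord j))) !opprB.
have := @grid_boundary _ (fun i j => half_turn (F i j) (F i.+1 j))
  (fun i j => half_turn (F i j) (F i j.+1)) n.+1 n.+1.
rewrite -!gE // -{1}x0 -x1 -x0; apply=> i j lin ljn.
have x01W k : (k < n.+1)%N -> x k \in `[0, 1]%R by move=> /ltnW/x01.
have xx k : `|x k - x k| <= n.+1%:R^-1 by rewrite subrr normr0.
apply: half_turn_square (nP (x i) (x j) (x01W _ lin) (x01W _ ljn)) _ _ _ _.
all: do 2 eexists; split; last reflexivity.
all: by [exact: x01 | exact: x01W | exact: xx | exact: xS].
Qed.

End Arcs.

(** * Nonplanarity of K33 *)

Lemma K33_arcs_meet (R : realType) (a b : 'I_3 -> R * R)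
    (f : 'I_3 -> 'I_3 -> R -> R * R) :
  (forall i j, {within `[0, 1], continuous (f i j)}) ->
  (forall i j, f i j 0 = a i) -> (forall i j, f i j 1 = b j) ->
  exists i j k l s t, [/\ i != k, j != l, s \in `[0, 1]%R, t \in `[0, 1]%R
    & f i j s = f k l t].
Proof.
move=> cf fa fb; apply: contrapT => disj.
have fdisj i j k l : i != k -> j != l -> forall s t : R,
    s \in `[0, 1]%R -> t \in `[0, 1]%R -> f i j s != f k l t.
  move=> ik jl s t s01 t01; apply/eqP => fst.
  by apply: disj; exists i, j, k, l, s, t.
(* There are finitely many pairs of edges, so one subdivision serves them all. *)
have : \forall n \near \oo, forall i j k l : 'I_3, i != k -> j != l ->
    half_turns n (f i j) (a k) + half_turns n (f k l) (b j) =
    half_turns n (f k l) (a i) + half_turns n (f i j) (b l).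
  apply: filter_forall => i; apply: filter_forall => j.
  apply: filter_forall => k; apply: filter_forall => l.
  have [->|ik] := eqVneq i k; first exact: nearW.
  have [->|jl] := eqVneq j l; first exact: nearW.
  rewrite -(fa k l) -(fb i j) -(fa i j) -(fb k l).
  by apply: filterS (half_turns_rectangle _ _ (fdisj _ _ _ _ ik jl)).
move=> [n _ /(_ n (leqnn n)) /= rect].
have par i j l : exists k : int, half_turns n (f i j) (b l) =
    (upper (a i - b l))%:Z + (upper (b j - b l))%:Z + 2 * k.
  by rewrite -(fa i j) -(fb i j); exact: half_turns_parity.
have upperC j l : j != l ->
    (upper (b j - b l))%:Z + (upper (b l - b j))%:Z = 1.
  move=> jl; rewrite -(opprB (b j)) upperN; first by case: upper.
  rewrite subr_eq0 -(fb ord0 j) -(fb (lift ord0 ord0) l).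
  by apply: fdisj; rewrite ?bound_itvE.
pose o0 : 'I_3 := ord0.
pose o1 : 'I_3 := lift ord0 ord0.
pose o2 : 'I_3 := ord_max.
have o01 : o0 != o1 by [].
have o02 : o0 != o2 by [].
have o12 : o1 != o2 by [].
have [k01 p01] := par o0 o0 o1; have [k10 p10] := par o0 o1 o0.
have [k02 p02] := par o0 o0 o2; have [k20 p20] := par o0 o2 o0.
have [k12 p12] := par o0 o1 o2; have [k21 p21] := par o0 o2 o1.
have u01 := upperC _ _ o01; have u02 := upperC _ _ o02.
have u12 := upperC _ _ o12.
have o10 : o1 != o0 by [].
have o20 : o2 != o0 by [].
have o21 : o2 != o1 by [].
have E i k j l ik jl lj := (rect i j k l ik jl, rect i l k j ik lj).
have [[E0101 E0101'] [[E0102 E0102'] [E0112 E0112']]] :=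
  (E _ _ _ _ o01 o01 o10, (E _ _ _ _ o01 o02 o20, E _ _ _ _ o01 o12 o21)).
have [[E0201 E0201'] [[E0202 E0202'] [E0212 E0212']]] :=
  (E _ _ _ _ o02 o01 o10, (E _ _ _ _ o02 o02 o20, E _ _ _ _ o02 o12 o21)).
have [[E1201 E1201'] [[E1202 E1202'] [E1212 E1212']]] :=
  (E _ _ _ _ o12 o01 o10, (E _ _ _ _ o12 o02 o20, E _ _ _ _ o12 o12 o21)).
(* Let [S i] be the sum over [j != l], with cyclic signs, of the half-turns of [f i j] seen from
   [b l]. For fixed [i != k], the relations with these signs add up to [S i + S k = 0]: each count
   seen from an [a] occurs once with each sign. The three pairs give [2 * S o0 = 0]. *)
have alternating :
  half_turns n (f o0 o0) (b o1) + half_turns n (f o0 o1) (b o2)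
    + half_turns n (f o0 o2) (b o0) =
  half_turns n (f o0 o1) (b o0) + half_turns n (f o0 o2) (b o1)
    + half_turns n (f o0 o0) (b o2).
  by clear p01 p10 p02 p20 p12 p21 u01 u02 u12; lia.
clear -p01 p10 p02 p20 p12 p21 u01 u02 u12 alternating.
(* Modulo 2 the six counts add up to 1: each [upper (a o0 - b l)] occurs twice, and the other terms
   form three pairs of sum 1. But [alternating] makes the total even. *)
lia.
Qed.

Lemma planar_no_K33 (R : realType) (T : finType) (e : rel T)
    (A B : 'I_3 -> T) :
  simple_graph e -> planar R e -> injective A -> injective B ->
  ~ (forall i j, e (A i) (B j)).
Proof.
move=> [_ irr] [p [arc [p_inj arcs no_vertex no_edge]]] A_inj B_inj eAB.
have AB i j : A i <> B j by move=> AB; have := eAB i j; rewrite AB irr.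
have /choice[F FP] (ij : 'I_3 * 'I_3) : exists g : R -> R * R,
    [/\ {within `[0, 1], continuous g}, g 0 = p (A ij.1), g 1 = p (B ij.2)
      & arc [set A ij.1; B ij.2]%SET = g @` `[0, 1]].
  by have [g [? _ ? ? ?]] := arcs _ _ (eAB ij.1 ij.2); exists g.
have Farc i j s : s \in `[0, 1]%R -> arc [set A i; B j]%SET (F (i, j) s).
  by have [_ _ _ ->] := FP (i, j); exists s.
have [||| i [j [k [l [s [t [ik jl s01 t01 st]]]]]]] :=
    @K33_arcs_meet R (p \o A) (p \o B) (fun i j => F (i, j)).
- by move=> i j; have [] := FP (i, j).
- by move=> i j; have [] := FP (i, j).
- by move=> i j; have [] := FP (i, j).
have zij := Farc i j s s01; have := Farc k l t t01; rewrite -st => zkl.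
have Aik : A i <> A k by move=> /A_inj/eqP; apply/negP.
have Bjl : B j <> B l by move=> /B_inj/eqP; apply/negP.
(* Lying on the second edge, the common point can be no vertex but an end of that edge; so it is
   interior to the first edge, against [no_edge]. *)
have off x : x <> A k -> x <> B l -> F (i, j) s <> p x.
  move=> xA xB zx; apply: (no_vertex _ _ x (eAB k l)); rewrite -zx; split => //.
  by rewrite zx => -[] /p_inj.
have zA : F (i, j) s <> p (A i) by apply: off.
have zB : F (i, j) s <> p (B j) by apply: off => // /esym/AB.
have edges_neq : [set A i; B j]%SET <> [set A k; B l]%SET.
  by move=> /setP/(_ (A i)); rewrite !inE eqxx /= => /esym/orP[] /eqP // /AB.
have := no_edge _ _ _ _ (eAB i j) (eAB k l) edges_neq.
by rewrite -subset0 => /(_ (F (i, j) s)); apply; do 2 split => //; case.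
Qed.

(** * Total dominating pairs and common neighbours *)

Lemma min_degree_le (T : finType) (e : rel T) (v : T) :
  (min_degree e <= degree e v)%N.
Proof.
rewrite /min_degree; have := mem_index_enum v.
elim: (index_enum T) => // w s IH.
rewrite inE big_cons geq_min => /predU1P[->|/IH ->]; last by rewrite orbT.
by rewrite leqnn.
Qed.

Lemma wtd_minset_card (k : nat) (T : finType) (e : rel T) (S : {set T}) :
  wtd k e -> minset (total_dominating e) S -> #|S| = k.
Proof.
move=> [[no_iso same] <-] minS; apply: same minS _.
have dominatingT : total_dominating e [set: T]%SET.
  apply/forallP => v; have /existsP[u vu] := forallP no_iso v.
  by apply/existsP; exists u; rewrite inE.
(* A total dominating set of least size is also minimal for inclusion. *)
case: arg_minnP => // S0 S0_dom S0_min; apply/minsetP; split => // B B_dom BS0.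
by apply/eqP; rewrite eqEcard BS0 S0_min.
Qed.

Lemma wtd2_avoiding_pair (T : finType) (e : rel T) (x y : T) :
  wtd 2 e -> (3 <= min_degree e)%N ->
  exists q : bool -> T,
    (forall c, q c \notin [set x; y]%SET) /\ (forall w, exists c, e w (q c)).
Proof.
move=> e_wtd2 e_deg.
have dom : total_dominating e (~: [set x; y]%SET).
  (* A vertex with all its neighbours among [x] and [y] would have degree at most 2. *)
  apply/forallP => v; apply/existsP; apply: contrapT => /forallNP none.
  have := leq_trans e_deg (min_degree_le e v); rewrite ltnNge => /negP; apply.
  apply: leq_trans (_ : #|[set x; y]%SET| <= 2)%N; last first.
    by rewrite cards2; case: eqP.
  apply/subset_leq_card/fintype.subsetP => u evu; apply: contrapT => /negP uxy.
  by apply: (none u); rewrite inE uxy.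
have [S minS Sxy] := minset_exists dom.
have /eqP/cards2P[u [v [_ SE]]] := wtd_minset_card e_wtd2 minS.
exists (fun c => if c then u else v); split=> [c | w].
  have /fintype.subsetP/(_ (if c then u else v)) := Sxy.
  rewrite [_ \in ~: _]inE; apply.
  by rewrite SE !inE; case: c; rewrite eqxx ?orbT.
have /minsetp/forallP/(_ w)/existsP[z] := minS.
rewrite SE !inE => /andP[/orP[] /eqP -> ewz]; by [exists true | exists false].
Qed.

Lemma wtd2_common_neighbours (T : finType) (e : rel T) :
  wtd 2 e -> (3 <= min_degree e)%N -> (16 < #|T|)%N ->
  exists A B : 'I_3 -> T,
    [/\ injective A, injective B & forall i j, e (A i) (B j)].
Proof.
move=> e_wtd2 e_deg T_gt16.
have /choice[q qP] (xy : T * T) := wtd2_avoiding_pair xy.1 xy.2 e_wtd2 e_deg.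
have /card_gt0P[x0 _] : (0 < #|T|)%N by exact: leq_trans T_gt16.
(* The three booleans record the successive choices: [b1] reads the first, [b2] the first two. The
   vertex [x0] is an arbitrary start. *)
pose b1 (c : bool * bool * bool) := q (x0, x0) c.1.1.
pose b2 (c : bool * bool * bool) := q (b1 c, b1 c) c.1.2.
pose b3 (c : bool * bool * bool) := q (b1 c, b2 c) c.2.
have /choice[phi phiP] w :
    exists c, [/\ e w (b1 c), e w (b2 c) & e w (b3 c)].
  have [c1 ec1] := (qP (x0, x0)).2 w.
  have [c2 ec2] := (qP (b1 (c1, true, true), b1 (c1, true, true))).2 w.
  have [c3 ec3] := (qP (b1 (c1, true, true), b2 (c1, c2, true))).2 w.
  by exists (c1, c2, c3).
(* Pigeonhole: eight classes of at most two vertices hold at most 16. *)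
have [c fiber] : exists c, (2 < #|[set w | phi w == c]%SET|)%N.
  apply: contrapT => /forallNP small.
  move: T_gt16; rewrite ltnNge => /negP; apply.
  rewrite -sum1_card (partition_big phi xpredT) //=.
  apply: leq_trans (_ : \sum_(c : bool * bool * bool) 2 <= 16)%N; last first.
    by rewrite sum_nat_const !card_prod card_bool.
  apply: leq_sum => c _; rewrite sum1dep_card leqNgt; apply/negP.
  exact: small.
exists (fun i : 'I_3 => enum_val (widen_ord fiber i)).
exists (tnth [tuple b1 c; b2 c; b3 c]); split.
- by move=> i j /enum_val_inj/(congr1 val)/= ij; exact: val_inj.
(* Each member of the triple was chosen to avoid the earlier ones. *)
- apply/tuple_uniqP => /=; have := (qP (b1 c, b1 c)).1 c.1.2.
  have := (qP (b1 c, b2 c)).1 c.2; rewrite !inE !negb_or -/(b2 c) -/(b3 c) /=.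
  by rewrite ![_ == b1 c]eq_sym [_ == b2 c]eq_sym => /andP[-> ->] /andP[->].
- move=> i j; have := enum_valP (widen_ord fiber i); rewrite inE => /eqP.
  have := phiP (enum_val (widen_ord fiber i)) => /[swap] -> [].
  by case: j => -[|[|[]]].
Qed.

Theorem theorem3p15 (R : realType) (T : finType) (e : rel T)
  (e_simple : simple_graph e) (e_planar : planar R e) (e_wtd2 : wtd 2 e)
  (e_min_degree : (3 <= min_degree e)%N) :
  (#|T| <= 16)%N.
Proof.
rewrite leqNgt; apply/negP.
move=> /(wtd2_common_neighbours e_wtd2 e_min_degree)[A [B [A_inj B_inj eAB]]].
exact: planar_no_K33 e_simple e_planar A_inj B_inj eAB.
Qed.
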